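(* Let $d\in\mathbb N$, let $\mathcal H$ be a complex Hilbert space, and let $r\in\mathbb R_+$. The sets $\mathrm{Toepl}^\rho_{d,\mathcal H}(r)$ and $\mathrm{Toepl}^\omega_{d,\mathcal H}(r)$ are operator convex, in the following sense: for every $\ell\in\mathbb N$, every Hilbert space $\mathcal K$, and all bounded operators $X_1,\dots,X_\ell:\mathcal K\to\mathcal H$ with $\sum_{k=1}^\ell X_k^*X_k=1_{\mathcal K}$, (i) if $\mathsf T_1,\dots,\mathsf T_\ell\in\mathrm{Toepl}^\rho_{d,\mathcal H}(r)$, then $\sum_{k=1}^\ell X_k^*\cdot\mathsf T_k\cdot X_k\in\mathrm{Toepl}^\rho_{d,\mathcal K}(r)$; and (ii) if $\mathsf T_1,\dots,\mathsf T_\ell\in\mathrm{Toepl}^\omega_{d,\mathcal H}(r)$, then $\sum_{k=1}^\ell X_k^*\cdot\mathsf T_k\cdot X_k\in\mathrm{Toepl}^\omega_{d,\mathcal K}(r)$.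
   Context: $\mathcal B(\mathcal H)$ is the algebra of bounded operators on the Hilbert space $\mathcal H$. Let $\mathsf T=(T_1,\dots,T_d)\in\mathcal B(\mathcal H)^d$ and $\alpha\in\mathbb R_+=[0,\infty)$. Positive means positive semidefinite. Let $\mathcal T_\alpha$ be the $(d+1)\times(d+1)$ Toeplitz operator matrix on $\bigoplus_1^{d+1}\mathcal H$ whose $(i,j)$ entry is $\alpha 1_{\mathcal H}$ if $i=j$, $T_{i-j}$ if $i>j$, and $T_{j-i}^*$ if $i<j$. The Toeplitz modulus is $\rho(\mathsf T)=\inf\{\alpha\in\mathbb R_+ : \mathcal T_\alpha\text{ is positive}\}$. For $\xi\in\mathcal H$, let $\mathcal T_{\alpha,\xi}$ be the $(d+1)\times(d+1)$ complex Toeplitz matrix whose $(i,j)$ entry is $\alpha$ if $i=j$, $\langle T_{i-j}\xi,\xi\rangle$ if $i>j$, and $\langle T_{j-i}^*\xi,\xi\rangle$ if $i<j$. The Toeplitz numerical radius is $\omega(\mathsf T)=\inf\{\alpha\in\mathbb R_+ : \mathcal T_{\alpha,\xi}\text{ is positive for every unit vector }\xi\in\mathcal H\}$. $\mathrm{Toepl}^\rho_{d,\mathcal H}(r)=\{\mathsf T\in\mathcal B(\mathcal H)^d:\rho(\mathsf T)\le r\}$ and $\mathrm{Toepl}^\omega_{d,\mathcal H}(r)=\{\mathsf T\in\mathcal B(\mathcal H)^d:\omega(\mathsf T)\le r\}$. For a bounded operator $X:\mathcal K\to\mathcal H$, $X^*\cdot\mathsf T\cdot X=(X^*T_1X,\dots,X^*T_dX)\in\mathcal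 B(\mathcal K)^d$; sums of $d$-tuples are entrywise. *)

(* Defs.v *)
From HB Require Import structures.
From mathcomp Require Import all_boot all_order all_algebra.
From mathcomp Require Import complex.
From mathcomp Require Import all_classical all_reals all_analysis.
From mathcomp Require Import lra ring.

Set Implicit Arguments.
Unset Strict Implicit.
Unset Printing Implicit Defensive.

Import Order.TTheory GRing.Theory Num.Theory.
Import numFieldNormedType.Exports.

Local Open Scope classical_set_scope.
Local Open Scope ring_scope.
Local Open Scope complex_scope.

(* The inner product is linear in its first argument. *)
HB.mixin Record CompleteNormedModule_isHilbert (R : realType) H
    & CompleteNormedModule R[i] H := {
  inner : H -> H -> R[i];
  innerDZl : forall (a : R[i]) (x y z : H),
    inner (a *: x + y) z = a * inner x z + inner y z;
  innerJ : forall x y : H, inner y x = (inner x y)^*;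
  innerxx : forall x : H, inner x x = `|x| ^+ 2
}.

#[short(type="hilbertType")]
HB.structure Definition Hilbert (R : realType) :=
  {H of CompleteNormedModule R[i] H & CompleteNormedModule_isHilbert R H}.

Section InnerProduct.
Context {R : realType} {H : hilbertType R}.
Implicit Types (x y z : H) (a : R[i]) (t : R).

Lemma innerDl x y z : inner (x + y) z = inner x z + inner y z.
Proof. by rewrite -[x]scale1r innerDZl mul1r scale1r. Qed.

Lemma inner0l x : inner 0 x = 0 :> R[i].
Proof. by apply: (addrI (inner 0 x)); rewrite -innerDl !addr0. Qed.

Lemma innerZl a x z : inner (a *: x) z = a * inner x z.
Proof. by rewrite -[a *: x]addr0 innerDZl inner0l addr0. Qed.

Lemma innerNl x z : inner (- x) z = - inner x z.
Proof. by rewrite -scaleN1r innerZl mulN1r. Qed.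

Lemma innerBl x y z : inner (x - y) z = inner x z - inner y z.
Proof. by rewrite innerDl innerNl. Qed.

Lemma innerDr x y z : inner z (x + y) = inner z x + inner z y.
Proof. by rewrite innerJ innerDl rmorphD /= -!innerJ. Qed.

Lemma innerZr a x z : inner z (a *: x) = a^* * inner z x.
Proof. by rewrite innerJ innerZl rmorphM /= -!innerJ. Qed.

Lemma innerNr x z : inner z (- x) = - inner z x.
Proof. by rewrite innerJ innerNl rmorphN /= -!innerJ. Qed.

Lemma innerBr x y z : inner z (x - y) = inner z x - inner z y.
Proof. by rewrite innerDr innerNr. Qed.

Let N x : R := complex.Re `|x|.
Let D x y : R := complex.Re (inner x y).

Lemma normE x : `|x| = (complex.Re `|x|)%:C.
Proof. by have := normr_ge0 x; rewrite lecE /=; case: `|x| => a b /= /andP[/eqP-> _]. Qed.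

Let NE x : `|x| = (N x)%:C := normE x.

Let N_ge0 x : 0 <= N x.
Proof. by rewrite -ler0c -NE. Qed.

Let ND x y : N (x + y) <= N x + N y.
Proof. by rewrite -lecR rmorphD /= -!NE ler_normD. Qed.

Let DC x y : D x y = D y x.
Proof. by rewrite /D innerJ; case: (inner y x). Qed.

Let DDl x y z : D (x + y) z = D x z + D y z.
Proof. by rewrite /D innerDl raddfD. Qed.

Let DNl x z : D (- x) z = - D x z.
Proof. by rewrite /D innerNl raddfN. Qed.

Let DZl t x z : D (t%:C *: x) z = t * D x z.
Proof. by rewrite /D innerZl; case: (inner x z) => a b /=; rewrite mul0r subr0. Qed.

Let DDr x y z : D z (x + y) = D z x + D z y.
Proof. by rewrite DC DDl !(DC z). Qed.

Let DNr x z : D z (- x) = - D z x.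
Proof. by rewrite DC DNl !(DC z). Qed.

Let DZr t x z : D z (t%:C *: x) = t * D z x.
Proof. by rewrite DC DZl (DC z). Qed.

Let Dxx x : D x x = N x ^+ 2.
Proof. by rewrite /D innerxx NE -rmorphXn. Qed.

Lemma Re_inner_le x y :
  complex.Re (inner x y) <= complex.Re `|x| * complex.Re `|y|.
Proof.
rewrite -/(D x y) -/(N x) -/(N y).
have := ND x y; have := N_ge0 (x + y).
have := N_ge0 x; have := N_ge0 y.
have := Dxx (x + y); rewrite DDl !DDr !Dxx (DC y x).
by nra.
Qed.

(* For linear f : H -> R[i], a functional is determined by its real part, and
   the representing vector minimizes N x ^+ 2 - 2 * Re (f x). *)
Lemma riesz (f : H -> R[i]) (M : R) :
  linear_for *%R f -> (forall x, complex.Re (f x) <= M * complex.Re `|x|) ->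
  exists z, forall x, f x = inner x z.
Proof.
move=> flin fM.
have f0 : f 0 = 0.
  have := flin 1 0 0; rewrite scale1r mul1r addr0 => /esym/eqP.
  by rewrite -subr_eq0 addrK => /eqP.
have fD x y : f (x + y) = f x + f y by rewrite -[x]scale1r flin mul1r scale1r.
have fZ a x : f (a *: x) = a * f x by rewrite -[a *: x]addr0 flin f0 addr0.
pose g x : R := complex.Re (f x).
have gD x y : g (x + y) = g x + g y by rewrite /g fD raddfD.
have gZ t x : g (t%:C *: x) = t * g x.
  by rewrite /g fZ; case: (f x) => a b /=; rewrite mul0r subr0.
have gM x : g x <= M * N x by exact: fM.
pose J x : R := N x ^+ 2 - 2 * g x.
pose S : set R := range J.
have Slb : lbound S (- M ^+ 2).
  move=> _ [x _ <-]; rewrite /J.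
  have := gM x; have := sqr_ge0 (N x - M); rewrite sqrrB; nra.
have Si : has_inf S by split; [exists (J 0), 0 | exists (- M ^+ 2)].
set mu := inf S.
have mule x : mu <= J x by apply: (ge_inf Si.2); exists x.
have muex e : 0 < e -> exists x, J x < mu + e.
  by move=> e0; have [_ [x _ <-] xlt] := inf_adherent e0 Si; exists x.
have par x y : N (x - y) ^+ 2 <= 2 * (J x - mu) + 2 * (J y - mu).
  have := mule ((2^-1 : R)%:C *: (x + y)); rewrite /J -!Dxx.
  rewrite gZ gD DZl DZr !DDl !DDr !DNl !DNr (DC y x).
  by lra.
pose B e : set H := [set x | J x < mu + e].
pose F : set_system H := filter_from [set e : R | 0 < e] B.
have FF : ProperFilter F.
  apply: filter_from_proper; last by move=> e /muex.
  apply: filter_from_filter; first by exists 1; exact: ltr01.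
  move=> e e' /= e0 e'0; exists (Num.min e e'); first by rewrite lt_min e0.
  by move=> x; rewrite /B /= => xe; split; apply: lt_le_trans xe _;
    rewrite lerD2l ge_min lexx ?orbT.
have Fc : cauchy F.
  apply: cauchy_exP => -[e e'] /=; rewrite ltcE /= => /andP[/eqP-> e0].
  have d0 : 0 < e ^+ 2 / 4 by rewrite divr_gt0 // exprn_gt0.
  have [x xB] := muex _ d0; exists x; exists (e ^+ 2 / 4) => // y yB.
  rewrite -ball_normE /= NE ltcR.
  have := par x y; have := N_ge0 (x - y); move: xB yB; rewrite /B /=.
  set a := N _; move=> h1 h2 h3 h4.
  rewrite -(@ltr_pXn2r _ 2) ?nnegrE ?(ltW e0) //.
  by lra.
have /cvg_ex[z /= Fz] : cvg F by exact: cauchy_cvg Fc.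
have Fz' d : 0 < d -> exists2 x, J x < mu + d & N (z - x) < d.
  move=> d0.
  have : F (ball z d%:C) by apply: Fz; apply: nbhsx_ballx; rewrite ltcR.
  move=> [e e0 eB].
  have [x xB] : exists x, J x < mu + Num.min e d.
    by apply: muex; rewrite lt_min e0 d0.
  exists x; first by apply: lt_le_trans xB _; rewrite lerD2l ge_min lexx orbT.
  have : ball z d%:C x.
    by apply: eB; apply: lt_le_trans xB _; rewrite lerD2l ge_min lexx.
  by rewrite -ball_normE /= NE ltcR.
have key h t : 0 <= 2 * t * (D z h - g h) + t ^+ 2 * N h ^+ 2.
  apply/ler_addgt0Pr => e e0.
  have c0 : 0 < 1 + 2 * `|t| * N h.
    by rewrite ltr_pwDl // !mulr_ge0.
  have [] := Fz' (e / (1 + 2 * `|t| * N h)); first by rewrite divr_gt0.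
  set d := e / _ => x Jx xz.
  have de : d * (1 + 2 * `|t| * N h) = e by rewrite divfK // gt_eqF.
  have := mule (x + t%:C *: h); rewrite /J -Dxx gD gZ DDl !DDr !DZl !DZr.
  rewrite !Dxx (DC h x) => h1.
  have tD : - (t * D (z - x) h) <= `|t| * (d * N h).
    have h2 : `|D (z - x) h| <= d * N h.
      apply: (@le_trans _ _ (N (z - x) * N h)); last first.
        by rewrite ler_wpM2r // ltW.
      rewrite ler_norml Re_inner_le andbT lerNl -DNl.
      have NN : N (- (z - x)) = N (z - x) by rewrite /N normrN.
      by rewrite -NN Re_inner_le.
    apply: (@le_trans _ _ `|t * D (z - x) h|).
      by rewrite -normrN ler_norm.
    by rewrite normrM ler_wpM2l.
  move: Jx tD; rewrite /J DDl DNl.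
  by move: de; rewrite mulrDr mulr1; lra.
have zg h : g h = D h z.
  rewrite (DC h); apply/eqP; rewrite eq_sym -subr_eq0; apply/eqP.
  set c := _ - _.
  have b0 : 0 < 1 + N h ^+ 2 by rewrite ltr_pwDl // sqr_ge0.
  have := key h (- c / (1 + N h ^+ 2)); rewrite -/c.
  set b := 1 + _ in b0 *.
  have -> : 2 * (- c / b) * c + (- c / b) ^+ 2 * N h ^+ 2 =
      - (c / b) ^+ 2 * (b + 1).
    have -> : N h ^+ 2 = b - 1 by rewrite /b; ring.
    by field; rewrite gt_eqF.
  rewrite mulNr oppr_ge0 pmulr_lle0; last by lra.
  rewrite -[_ <= 0]andbT -(sqr_ge0 (c / b)) -eq_le sqrf_eq0 mulf_eq0 invr_eq0.
  by rewrite (gt_eqF b0) orbF => /eqP.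
exists z => x; apply/eqP; rewrite eq_complex; apply/andP; split.
  exact/eqP/zg.
have := zg ('i *: x); rewrite /g /D fZ innerZl.
case: (f x) => a b; case: (inner x z) => a' b' /=.
by rewrite !mul0r !sub0r !mul1r => /oppr_inj ->.
Qed.

Lemma inner_inj x y : (forall z, inner z x = inner z y) -> x = y.
Proof.
move=> xy; apply/eqP; rewrite -subr_eq0 -normr_eq0 -sqrf_eq0 -innerxx.
by rewrite innerBr xy subrr.
Qed.

End InnerProduct.

Section BoundedOperators.
Context {R : realType}.
Implicit Types U V W : hilbertType R.

Definition bounded_linear {U V} : {pred U -> V} := fun f =>
  `[< linear f /\ exists M : R, forall x, `|f x| <= M%:C * `|x| >].

Lemma bounded_linear_submod U V : submod_closed (@bounded_linear U V).
Proof.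
split.
  apply/asboolP; split; first by move=> a x y; rewrite /= scaler0 addr0.
  by exists 0 => x; rewrite normr0 mul0r.
move=> a f g /asboolP[fl [M fM]] /asboolP[gl [M' gM]].
have hE z : (a *: f + g) z = a *: f z + g z by [].
apply/asboolP; split.
  move=> b x y /=; rewrite !hE fl gl !scalerDr !scalerA [b * a]mulrC.
  by rewrite addrACA.
exists (complex.Re `|a| * M + M') => x.
have aE : `|a| = (complex.Re `|a|)%:C by [].
rewrite hE rmorphD rmorphM /= -aE mulrDl -mulrA.
apply: le_trans (ler_normD _ _) _; apply: lerD => //.
by rewrite normrZ ler_wpM2l.
Qed.

HB.instance Definition _ U V := GRing.isSubmodClosed.Build R[i] (U -> V)
  (@bounded_linear U V) (@bounded_linear_submod U V).

Record bop U V := Bop {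
  bop_fun :> U -> V;
  bop_bounded_linear : bop_fun \in bounded_linear }.

HB.instance Definition _ U V := [isSub for @bop_fun U V].
HB.instance Definition _ U V := [Choice of bop U V by <:].
HB.instance Definition _ U V := [SubChoice_isSubLmodule of bop U V by <:].

Lemma bopP {U V} (X : bop U V) :
  linear X /\ exists M : R, forall x, `|X x| <= M%:C * `|x|.
Proof. exact/asboolP/bop_bounded_linear. Qed.

Lemma bop_id_subproof U : (@idfun U) \in bounded_linear.
Proof. by apply/asboolP; split=> //; exists 1 => x; rewrite mul1r. Qed.

Definition bop_id U : bop U U := Bop (bop_id_subproof U).

Lemma bop_comp_subproof U V W (X : bop V W) (Y : bop U V) :
  X \o Y \in bounded_linear.
Proof.
have [Xl [M XM]] := bopP X; have [Yl [M' YM]] := bopP Y.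
apply/asboolP; split; first by move=> a x y; rewrite /= Yl Xl.
exists (`|M| * M') => x; rewrite rmorphM /= -mulrA.
apply: le_trans (XM _) _.
apply: (@le_trans _ _ (`|M|%:C * `|Y x|)).
  by rewrite ler_wpM2r // lecR ler_norm.
by rewrite ler_wpM2l // ler0c.
Qed.

Definition bop_comp U V W (X : bop V W) (Y : bop U V) : bop U W :=
  Bop (bop_comp_subproof X Y).

Lemma adj_exists U V (X : bop U V) :
  exists Y : bop V U, forall x y, inner (X x) y = inner x (Y y).
Proof.
have [Xl [M XM]] := bopP X.
have XM' x : complex.Re `|X x| <= `|M| * complex.Re `|x|.
  rewrite -lecR rmorphM /= -!normE; apply: le_trans (XM x) _.
  by rewrite ler_wpM2r // lecR ler_norm.
have N_ge0 W (x : W) : 0 <= complex.Re `|x| by rewrite -ler0c -normE.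
have /choice[Y YP] y : exists z, forall x, inner (X x) y = inner x z.
  apply: (@riesz _ _ (fun x => inner (X x) y) (`|M| * complex.Re `|y|)).
    by move=> a x x'; rewrite Xl innerDZl.
  move=> x; apply: le_trans (Re_inner_le _ _) _.
  by rewrite mulrAC ler_wpM2r.
have Yb : Y \in bounded_linear.
  apply/asboolP; split.
    move=> a y y'; apply: inner_inj => x.
    by rewrite -YP !(innerDr, innerZr) !YP.
  exists `|M| => y; rewrite (normE (Y y)) (normE y) -rmorphM lecR.
  have [->|Y0] := eqVneq (Y y) 0; first by rewrite normr0 mulr_ge0.
  have Y1 : 0 < complex.Re `|Y y|.
    by rewrite lt_def N_ge0 andbT; apply: contraNneq Y0 => Y0;
      rewrite -normr_eq0 normE Y0.
  rewrite -(ler_pM2l Y1).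
  have -> : complex.Re `|Y y| * complex.Re `|Y y| =
      complex.Re (inner (Y y) (Y y)).
    by rewrite innerxx normE -rmorphXn /= expr2.
  rewrite -YP; apply: le_trans (Re_inner_le _ _) _.
  by rewrite mulrA ler_wpM2r // mulrC.
by exists (Bop Yb) => x y; rewrite YP.
Qed.

Definition adj U V (X : bop U V) : bop V U := sval (cid (adj_exists X)).

Lemma adjP U V (X : bop U V) x y : inner (X x) y = inner x (adj X y).
Proof. by rewrite /adj; case: cid. Qed.

End BoundedOperators.

(* A d-tuple (T_1, ..., T_d) is indexed from 0, so T_k is T (k - 1); entry T k is
   T_k for 1 <= k <= d, the only indices occurring in a Toeplitz matrix. *)
Notation optuple d H := {ffun 'I_d -> bop H H}.

Definition entry d (V : zmodType) (T : {ffun 'I_d -> V}) (k : nat) : V :=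
  oapp T 0 (insub k.-1).

Section Toeplitz.
Context {R : realType}.
Implicit Types H K : hilbertType R.

Definition toeplitz (V : Type) d (diag : V) (lower upper : nat -> V) :
    'M[V]_d.+1 :=
  \matrix_(i, j) if i == j then diag
                 else if (j < i)%N then lower (i - j)%N else upper (j - i)%N.

Definition toeplitz_op H d (alpha : R) (T : optuple d H) : 'M[bop H H]_d.+1 :=
  toeplitz d (alpha%:C *: bop_id H) (entry T) (fun k => adj (entry T k)).

Definition toeplitz_mx H d (alpha : R) (T : optuple d H) (xi : H) :
    'M[R[i]]_d.+1 :=
  toeplitz d alpha%:C (fun k => inner (entry T k xi) xi)
    (fun k => inner (adj (entry T k) xi) xi).

(* The Hilbert direct sum of n copies of H: an operator matrix acts on
   'I_n -> H as a matrix on columns. *)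
Definition dsum_inner H n (xi eta : 'I_n -> H) : R[i] :=
  \sum_i inner (xi i) (eta i).

Definition opmx_apply H n (A : 'M[bop H H]_n) (xi : 'I_n -> H) : 'I_n -> H :=
  fun i => \sum_j A i j (xi j).

(* In R[i], 0 <= z means that z is real and nonnegative. *)
Definition opmx_positive H n (A : 'M[bop H H]_n) : Prop :=
  forall xi : 'I_n -> H, 0 <= dsum_inner (opmx_apply A xi) xi.

Definition mx_positive n (A : 'M[R[i]]_n) : Prop :=
  forall v : 'cV[R[i]]_n, 0 <= (map_mx conjc v^T *m A *m v) 0 0.

(* Both sets below contain 2 * \sum_k ||T_k||, so that inf is never applied to
   the empty set. *)
Definition toeplitz_modulus H d (T : optuple d H) : R :=
  inf [set alpha : R | 0 <= alpha /\ opmx_positive (toeplitz_op alpha T)].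

Definition toeplitz_radius H d (T : optuple d H) : R :=
  inf [set alpha : R | 0 <= alpha /\
    forall xi : H, `|xi| = 1 -> mx_positive (toeplitz_mx alpha T xi)].

Definition Toepl_rho d H (r : R) : set (optuple d H) :=
  [set T | toeplitz_modulus T <= r].

Definition Toepl_omega d H (r : R) : set (optuple d H) :=
  [set T | toeplitz_radius T <= r].

Definition compress H K d (X : bop K H) (T : optuple d H) : optuple d K :=
  [ffun i => bop_comp (adj X) (bop_comp (T i) X)].

End Toeplitz.

(* Main.v *)
(* For x in K^(d+1), the quadratic form of T_alpha at the operator convex
   combination of the T_k is the sum over k of the quadratic forms of
   T_alpha(T_k) at (X_k x_0, ..., X_k x_d); the diagonal terms match because
   \sum_k X_k^* X_k = 1.  Positivity of all the scalar matrices T_(alpha, xi)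
   amounts to nonnegativity of the quadratic form of T_alpha on the elementary
   tensors (v_i xi)_i, and applying X_k entrywise preserves these.  Every
   alpha > r is admissible for each T_k because the set of admissible alpha is
   nonempty and upward closed. *)

Require Import Defs.
From mathcomp Require Import all_boot all_order all_algebra.
From mathcomp Require Import complex.
From mathcomp Require Import all_classical all_reals all_analysis.
From mathcomp Require Import lra.

Set Implicit Arguments.
Unset Strict Implicit.
Unset Printing Implicit Defensive.

Import Order.TTheory GRing.Theory Num.Theory.
Import numFieldNormedType.Exports.

Local Open Scope classical_set_scope.
Local Open Scope ring_scope.

Lemma inner_suml (R : realType) (H : hilbertType R) (I : Type) (s : seq I)
    (P : pred I) (F : I -> H) (y : H) :
  inner (\sum_(i <- s | P i) F i) y = \sum_(i <- s | P i) inner (F i) y.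
Proof.
by apply: (big_morph (fun x => inner x y)) => [x x'|];
  rewrite (innerDl, inner0l).
Qed.

Lemma inner_adjl (R : realType) (U V : hilbertType R) (A : bop U V) x y :
  inner (adj A y) x = inner y (A x).
Proof. by rewrite innerJ -adjP -innerJ. Qed.

Lemma bop_sumE (R : realType) (U V : hilbertType R) (I : Type) (s : seq I)
    (P : pred I) (A : I -> bop U V) (x : U) :
  (\sum_(i <- s | P i) A i) x = \sum_(i <- s | P i) A i x.
Proof. by apply: (big_morph (fun B : bop U V => B x)). Qed.

Lemma bop_scale (R : realType) (U V : hilbertType R) (A : bop U V) a x :
  A (a *: x) = a *: A x.
Proof.
have [A_lin _] := bopP A.
have A0 : A 0 = 0.
  by have := A_lin (-1) 0 0; rewrite scaler0 addr0 scaleN1r addNr.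
by rewrite -[a *: x]addr0 A_lin A0 addr0.
Qed.

Section ToeplitzForm.
Context {R : realType} {d : nat}.
Implicit Types (H K : hilbertType R) (alpha : R).

Definition opmx_form H n (A : 'M[bop H H]_n) (x : 'I_n -> H) : R[i] :=
  dsum_inner (opmx_apply A x) x.

Lemma opmx_formE H n (A : 'M[bop H H]_n) (x : 'I_n -> H) :
  opmx_form A x = \sum_i \sum_j inner (A i j (x j)) (x i).
Proof. by apply: eq_bigr => i _; rewrite inner_suml. Qed.

Lemma toeplitz_op_hermitian H alpha (T : optuple d H) i j x y :
  inner (toeplitz_op alpha T i j x) y = inner x (toeplitz_op alpha T j i y).
Proof.
rewrite !mxE eq_sym; case: eqVneq => [_|ij].
  by rewrite innerZl innerZr; congr (_ * _); exact/esym/conjc_real.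
case: (ltngtP i j) ij => [_ _|_ _|/val_inj ->]; last by rewrite eqxx.
  by rewrite inner_adjl.
by rewrite adjP.
Qed.

(** Isolating [alpha] as the factor of the squared norm of [x] makes the set of admissible [alpha]
    upward closed and, given a lower bound on the other term, nonempty. *)
Lemma toeplitz_form_diag H alpha (T : optuple d H) x :
  opmx_form (toeplitz_op alpha T) x =
  alpha%:C%C * (\sum_i `|x i| ^+ 2) + opmx_form (toeplitz_op 0 T) x.
Proof.
rewrite !opmx_formE mulr_sumr -big_split /=; apply: eq_bigr => i _.
rewrite [LHS](bigD1 i) //= [in RHS](bigD1 i) //= !mxE eqxx !innerZl innerxx.
rewrite mul0r add0r; congr (_ + _); apply: eq_bigr => j ij.
by rewrite !mxE eq_sym (negPf ij).
Qed.

(** The operator matrix is hermitian, so swapping [i] and [j] turns the conjugate of the double sum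
    into itself. The order on [R[i]] only compares numbers with equal imaginary parts, hence its use
    in the bound below. *)
Lemma toeplitz_form_real H alpha (T : optuple d H) x :
  complex.Im (opmx_form (toeplitz_op alpha T) x) = 0.
Proof.
set q := opmx_form _ _.
have : (q^*)%C = q.
  rewrite /q opmx_formE [RHS]exchange_big rmorph_sum /=; apply: eq_bigr => i _.
  rewrite rmorph_sum /=; apply: eq_bigr => j _.
  by rewrite -innerJ toeplitz_op_hermitian.
case: q => a b [] /eqP; rewrite eq_sym -subr_eq0 opprK -mulr2n.
by rewrite mulrn_eq0 /= => /eqP.
Qed.

(** [C] is the sum of norm bounds for the entries; Cauchy-Schwarz handles each term of the double
    sum. *)
Lemma toeplitz_form_bounded H (T : optuple d H) :
  exists2 C : R, 0 <= C & forall x,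
  - (C%:C%C * \sum_i `|x i| ^+ 2) <= opmx_form (toeplitz_op 0 T) x.
Proof.
pose A := toeplitz_op 0 T.
have /choice[M MP] (ij : 'I_d.+1 * 'I_d.+1) : exists M : R,
    0 <= M /\ forall x, complex.Re `|A ij.1 ij.2 x| <= M * complex.Re `|x|.
  have [_ [M AM]] := bopP (A ij.1 ij.2); exists `|M|; split=> // x.
  rewrite -lecR rmorphM /= -!normE; apply: le_trans (AM x) _.
  by rewrite ler_wpM2r // lecR ler_norm.
have N_ge0 (x : H) : 0 <= complex.Re `|x| by rewrite -ler0c -normE.
exists (\sum_i \sum_j M (i, j)).
  by apply: sumr_ge0 => i _; apply: sumr_ge0 => j _; case: (MP (i, j)).
move=> x.
pose S := \sum_i complex.Re `|x i| ^+ 2.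
have SE : \sum_i `|x i| ^+ 2 = S%:C%C.
  by rewrite rmorph_sum; apply: eq_bigr => i _; rewrite normE -rmorphXn.
have xS i : complex.Re `|x i| ^+ 2 <= S.
  by rewrite /S (bigD1 i) //= lerDl; apply: sumr_ge0 => j _; exact: sqr_ge0.
(* A product of two norms is at most the mean of their squares. *)
have xxS i j : complex.Re `|x j| * complex.Re `|x i| <= S.
  by have := xS i; have := xS j; have := N_ge0 (x i); have := N_ge0 (x j); nra.
rewrite SE -rmorphM -rmorphN lecE /= toeplitz_form_real eqxx /=.
rewrite opmx_formE raddf_sum mulr_suml -sumrN; apply: ler_sum => i _.
rewrite raddf_sum mulr_suml -sumrN; apply: ler_sum => j _.
have [M_ge0 AM] := MP (i, j).
(* The lower bound is the Cauchy-Schwarz upper bound for the negated first argument. *)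
rewrite lerNl -raddfN -innerNl; apply: le_trans (Re_inner_le _ _) _.
rewrite normrN; apply: le_trans (ler_wpM2r (N_ge0 _) (AM _)) _.
by rewrite -mulrA ler_wpM2l.
Qed.

Lemma entry_compress H K l (X : 'I_l -> bop K H) (T : 'I_l -> optuple d H)
    n x y :
  inner (entry (\sum_(k < l) compress (X k) (T k)) n x) y =
  \sum_(k < l) inner (entry (T k) n (X k x)) (X k y).
Proof.
(* For an index out of range every entry is the default [0], and both sides vanish. *)
rewrite /entry; case: insub => [i|] /=; last first.
  by rewrite inner0l big1 // => k _; rewrite inner0l.
rewrite sum_ffunE bop_sumE inner_suml; apply: eq_bigr => k _.
by rewrite ffunE /= inner_adjl.
Qed.

Lemma toeplitz_form_compress H K l (X : 'I_l -> bop K H)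
    (X_id : \sum_(k < l) bop_comp (adj (X k)) (X k) = bop_id K)
    (T : 'I_l -> optuple d H) alpha (x : 'I_d.+1 -> K) :
  opmx_form (toeplitz_op alpha (\sum_(k < l) compress (X k) (T k))) x =
  \sum_(k < l) opmx_form (toeplitz_op alpha (T k)) (X k \o x).
Proof.
under [RHS]eq_bigr do rewrite opmx_formE.
rewrite opmx_formE [RHS]exchange_big; apply: eq_bigr => i _.
rewrite [RHS]exchange_big; apply: eq_bigr => j _ /=.
under [RHS]eq_bigr do rewrite !mxE.
rewrite !mxE; case: eqVneq => _.
  under [RHS]eq_bigr do rewrite innerZl.
  rewrite innerZl -mulr_sumr; congr (_ * _).
  (* The identity is made explicit so that [X_id] can expand it. *)
  transitivity (inner (bop_id K (x j)) (x i)) => //.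
  rewrite -X_id bop_sumE inner_suml; apply: eq_bigr => k _.
  by rewrite /= inner_adjl.
case: ifP => _; first exact: entry_compress.
(* Terms above the diagonal are conjugates of terms below it. *)
rewrite inner_adjl innerJ entry_compress rmorph_sum; apply: eq_bigr => k _.
by rewrite /= -innerJ inner_adjl.
Qed.

(* The Toeplitz modulus and the Toeplitz numerical radius are both of this
   form: [S] consists of all vectors for the former and of the elementary
   tensors [(v_i xi)_i] for the latter. *)
Definition toeplitz_bounds H (S : set ('I_d.+1 -> H)) (T : optuple d H) :
    set R :=
  [set alpha | 0 <= alpha /\
    forall x, S x -> 0 <= opmx_form (toeplitz_op alpha T) x].

Lemma toeplitz_bounds_lb H S (T : optuple d H) :
  has_lbound (toeplitz_bounds S T).
Proof. by exists 0 => alpha []. Qed.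

Lemma toeplitz_bounds_inf H S (T : optuple d H) alpha :
  inf (toeplitz_bounds S T) < alpha -> toeplitz_bounds S T alpha.
Proof.
have Si : has_inf (toeplitz_bounds S T).
  split; last exact: toeplitz_bounds_lb.
  have [C C_ge0 CP] := toeplitz_form_bounded T.
  exists C; split=> // x _.
  by rewrite toeplitz_form_diag addrC -[X in _ + X]opprK subr_ge0.
rewrite -subr_gt0 => lt_alpha.
have [b [b_ge0 bP]] := inf_adherent lt_alpha Si.
rewrite addrC subrK => {lt_alpha} b_lt; split=> [|x Sx].
  exact: le_trans b_ge0 (ltW b_lt).
apply: le_trans (bP x Sx) _.
rewrite toeplitz_form_diag [leRHS]toeplitz_form_diag lerD2r.
apply: ler_wpM2r; last by rewrite lecR ltW.
by apply: sumr_ge0 => i _; exact: exprn_ge0.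
Qed.

Lemma toeplitz_bounds_compress H K l (X : 'I_l -> bop K H)
    (X_id : \sum_(k < l) bop_comp (adj (X k)) (X k) = bop_id K)
    (SH : set ('I_d.+1 -> H)) (SK : set ('I_d.+1 -> K))
    (XS : forall k x, SK x -> SH (X k \o x))
    (T : 'I_l -> optuple d H) (r : R) (r_ge0 : 0 <= r) :
  (forall k, inf (toeplitz_bounds SH (T k)) <= r) ->
  inf (toeplitz_bounds SK (\sum_(k < l) compress (X k) (T k))) <= r.
Proof.
(* The slack [e] puts [r + e] strictly above each infimum, so it is admissible for all [T k] at
   once, whether or not the infima are attained. *)
move=> Tr; apply/ler_addgt0Pr => e e_gt0.
apply: ge_inf; first exact: toeplitz_bounds_lb.
split=> [|x Sx]; first by rewrite addr_ge0 // ltW.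
rewrite toeplitz_form_compress //; apply: sumr_ge0 => k _.
have [|_] := @toeplitz_bounds_inf _ SH (T k) (r + e); last by apply; exact: XS.
by apply: le_lt_trans (Tr k) _; rewrite ltrDl.
Qed.

(** [xi] is not normalized: the maps [X k] need not preserve norms, and they must send elementary
    tensors to elementary tensors. *)
Definition elementary_tensors H : set ('I_d.+1 -> H) :=
  [set x | exists (v : 'I_d.+1 -> R[i]) (xi : H), x = fun i => v i *: xi].

Lemma toeplitz_mx_form H alpha (T : optuple d H) (xi : H) (v : 'cV[R[i]]_d.+1) :
  `|xi| = 1 ->
  (map_mx conjc v^T *m toeplitz_mx alpha T xi *m v) 0 0 =
  opmx_form (toeplitz_op alpha T) (fun i => v i 0 *: xi).
Proof.
(* The matrix product sums over columns outermost, hence the exchange. *)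
move=> xi1; rewrite opmx_formE exchange_big mxE; apply: eq_bigr => j _.
rewrite mxE mulr_suml; apply: eq_bigr => i _.
rewrite bop_scale innerZl innerZr mulrC; congr (_ * (_ * _)).
  by rewrite !mxE.
rewrite !mxE; case: eqVneq => _; last by case: ifP.
by rewrite innerZl innerxx xi1 expr1n mulr1.
Qed.

Lemma toeplitz_modulusE H (T : optuple d H) :
  toeplitz_modulus T = inf (toeplitz_bounds setT T).
Proof.
congr inf; apply/seteqP; split=> alpha [a0 aP]; split=> // x.
  by move=> _; exact: aP.
exact: aP.
Qed.

Lemma toeplitz_radiusE H (T : optuple d H) :
  toeplitz_radius T = inf (toeplitz_bounds (@elementary_tensors H) T).
Proof.
congr inf; apply/seteqP; split=> alpha [a0 aP]; split=> //; last first.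
  move=> xi xi1 v; rewrite toeplitz_mx_form //; apply: aP.
  by exists (fun i => v i 0), xi.
move=> _ [v [xi ->]]; have [->|xi0] := eqVneq xi 0.
  rewrite opmx_formE; apply: sumr_ge0 => i _; apply: sumr_ge0 => j _.
  by rewrite !scaler0 innerJ inner0l rmorph0.
(* A nonzero [xi] is normalized and its norm moved into the coefficients [v i]. *)
have nxi0 : `|xi| != 0 by rewrite normr_eq0.
have u1 : `|(`|xi|^-1 *: xi)| = 1 by rewrite normrZ normfV normr_id mulVf.
have := aP _ u1 (\col_i (v i * `|xi|)); rewrite toeplitz_mx_form //.
congr (0 <= opmx_form _ _); apply/funext => i.
by rewrite mxE scalerA mulfK.
Qed.

End ToeplitzForm.

Theorem proposition5p3 (R : realType) (d : nat) (H : hilbertType R) (r : R)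
    (r_ge0 : 0 <= r) (l : nat) (K : hilbertType R) (X : 'I_l -> bop K H)
    (X_id : \sum_(k < l) bop_comp (adj (X k)) (X k) = bop_id K) :
  (forall T : 'I_l -> optuple d H,
     (forall k, Toepl_rho r (T k)) ->
     Toepl_rho r (\sum_(k < l) compress (X k) (T k))) /\
  (forall T : 'I_l -> optuple d H,
     (forall k, Toepl_omega r (T k)) ->
     Toepl_omega r (\sum_(k < l) compress (X k) (T k))).
Proof.
split=> T Tr.
  rewrite /Toepl_rho /= toeplitz_modulusE.
  apply: (toeplitz_bounds_compress X_id (SH := setT)) => // k.
  by rewrite -toeplitz_modulusE; exact: Tr.
rewrite /Toepl_omega /= toeplitz_radiusE.
apply: (toeplitz_bounds_compress X_id (SH := @elementary_tensors _ _ _)) => //.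
  move=> k _ [v [xi ->]]; exists v, (X k xi); apply/funext => i /=.
  by rewrite bop_scale.
by move=> k; rewrite -toeplitz_radiusE; exact: Tr.
Qed.
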